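(* Let $\mathcal{A}^1_{+}$ (resp. $\mathcal{A}^1_{-}$) be the set of all $(a,b,c,d,e,f)\in\mathbb{R}^6$ such that the Ricci tensor of the Type $\mathcal{A}$ model $\mathcal{M}(a,b,c,d,e,f)$ has rank $1$ and is positive semi-definite (resp. negative semi-definite). Then each of $\mathcal{A}^1_{+}$ and $\mathcal{A}^1_{-}$ is a smooth submanifold of $\mathbb{R}^6$ diffeomorphic to $S^1\times S^1\times\mathbb{R}^3$.
   Context: For $(a,b,c,d,e,f)\in\mathbb{R}^6$, the Type $\mathcal{A}$ model $\mathcal{M}(a,b,c,d,e,f)$ is $(\mathbb{R}^2,\nabla)$ with torsion free connection whose constant Christoffel symbols ($\nabla_{\partial_{x^i}}\partial_{x^j}=\Gamma_{ij}{}^k\partial_{x^k}$) are $\Gamma_{11}{}^1=a$, $\Gamma_{11}{}^2=b$, $\Gamma_{12}{}^1=\Gamma_{21}{}^1=c$, $\Gamma_{12}{}^2=\Gamma_{21}{}^2=d$, $\Gamma_{22}{}^1=e$, $\Gamma_{22}{}^2=f$. Its Ricci tensor is the symmetric matrix $\rho=\begin{pmatrix}(a-d)d+b(f-c) & cd-be\\ cd-be & c(f-c)+(a-d)e\end{pmatrix}$. *)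

(* Defs.v *)
From HB Require Import structures.
From mathcomp Require Import all_boot all_order all_algebra.
From mathcomp Require Import all_classical all_reals all_analysis.
Set Implicit Arguments. Unset Strict Implicit. Unset Printing Implicit Defensive.
Import Order.TTheory GRing.Theory Num.Theory.
Import numFieldNormedType.Exports.
Local Open Scope classical_set_scope.
Local Open Scope ring_scope.

Section Defs.
Variable R : realType.

Definition coord (n : nat) (p : 'rV[R]_n.+1) (k : nat) : R := p ord0 (inord k).

Definition ricci (a b c d e f : R) : 'M[R]_2 :=
  \matrix_(i < 2, j < 2)
    if (i == 0 :> nat) && (j == 0 :> nat) then (a - d) * d + b * (f - c)
    else if (i == 1 :> nat) && (j == 1 :> nat) then c * (f - c) + (a - d) * e
    else c * d - b * e.

Definition ricciv (p : 'rV[R]_6) : 'M[R]_2 :=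
  ricci (coord p 0) (coord p 1) (coord p 2) (coord p 3) (coord p 4) (coord p 5).

Definition psd (M : 'M[R]_2) : Prop := forall v : 'cV[R]_2, 0 <= (v^T *m M *m v) ord0 ord0.
Definition nsd (M : 'M[R]_2) : Prop := forall v : 'cV[R]_2, (v^T *m M *m v) ord0 ord0 <= 0.

Definition A1plus : set 'rV[R]_6 := [set p | \rank (ricciv p) = 1%N /\ psd (ricciv p)].
Definition A1minus : set 'rV[R]_6 := [set p | \rank (ricciv p) = 1%N /\ nsd (ricciv p)].

Fixpoint iterD (V W : normedModType R) (vs : seq V) (f : V -> W) : V -> W :=
  if vs is v :: vs' then iterD vs' (fun x => derive f x v) else f.

Definition smooth (V W : normedModType R) (f : V -> W) : Prop :=
  forall vs : seq V, continuous (iterD vs f) /\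
    (forall (x v : V), derivable (iterD vs f) x v).

(* S^1 x S^1 x R^3, realized as a closed submanifold of R^7:
   (u1,u2,w1,w2,x1,x2,x3) with u1^2+u2^2 = 1 and w1^2+w2^2 = 1 *)
Definition T2R3 : set 'rV[R]_7 :=
  [set p | coord p 0 ^+ 2 + coord p 1 ^+ 2 = 1 /\ coord p 2 ^+ 2 + coord p 3 ^+ 2 = 1].

Definition T2R3_tangent (p v : 'rV[R]_7) : Prop :=
  coord p 0 * coord v 0 + coord p 1 * coord v 1 = 0 /\
  coord p 2 * coord v 2 + coord p 3 * coord v 3 = 0.

(* F is a smooth embedding of S^1 x S^1 x R^3 into R^6 with image A:
   F is (the restriction of) a smooth map, maps T2R3 onto A, is an immersion
   (injective differential on tangent spaces), and is a homeomorphism onto A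
   (continuous inverse on A). *)
Definition smooth_embedding_onto (F : 'rV[R]_7 -> 'rV[R]_6) (A : set 'rV[R]_6) : Prop :=
  [/\ smooth F,
      F @` T2R3 = A,
      (forall p v, T2R3 p -> T2R3_tangent p v -> v != 0 -> derive F p v != 0) &
      exists H : 'rV[R]_6 -> 'rV[R]_7,
        {within A, continuous H} /\ (forall p, T2R3 p -> H (F p) = p)].

Definition submanifold_diffeo_T2R3 (A : set 'rV[R]_6) : Prop :=
  exists F : 'rV[R]_7 -> 'rV[R]_6, smooth_embedding_onto F A.

End Defs.

(* Main.v *)
(** A type A model is encoded by the three plane vectors X = (d, b),
    Y = (e, c) and Z = (a - d, f - c): in these terms rho11 = <X, Z>,
    rho22 = <Y, Z> and rho12 = X ^ Y.  If rho is semi-definite of rank one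
    then its trace is nonzero, hence Z <> 0, so that Z = 2 m W with m > 0 and
    W on the unit circle.  Normalising rho gives a second point (C, S) of a
    circle, rho being half its trace times ((1 + C, S), (S, 1 - C)).  The
    W-components of X and Y are then prescribed by rho11 and rho22, while their
    components x, y along the rotated vector JW satisfy the single equation
    (1 + C) y - (1 - C) x = 2 m S, whose solutions form the line
    x = - m S + s (1 + C), y = m S + s (1 - C).  The parameters (C, S), W,
    ln m, ln |tr rho / (4 m)| and s give the diffeomorphism. *)
Require Import Defs.
From HB Require Import structures.
From mathcomp Require Import all_boot all_order all_algebra.
From mathcomp Require Import all_classical all_reals all_analysis.
From mathcomp Require Import ring lra.
Set Implicit Arguments. Unset Strict Implicit. Unset Printing Implicit Defensive.
Import Order.TTheory GRing.Theory Num.Theory.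
Import numFieldNormedType.Exports.
Import Defs.
Local Open Scope classical_set_scope.
Local Open Scope ring_scope.

(** * Calculus of row vectors, coordinate by coordinate *)

Section RowVectors.
Variables (R : realType) (n : nat).
Implicit Types p q : 'rV[R]_n.+1.

Lemma coord_row (g : nat -> R) k : (k <= n)%N ->
  coord (\row_(i < n.+1) g i) k = g k.
Proof. by move=> kn; rewrite /coord mxE inordK. Qed.

Lemma coord_inj p q : (forall k, (k <= n)%N -> coord p k = coord q k) -> p = q.
Proof.
move=> pq; apply/rowP => i; have := pq i (ltn_ord i).
by rewrite /coord inord_val.
Qed.

Lemma coord0 k : coord (0 : 'rV[R]_n.+1) k = 0.
Proof. by rewrite /coord mxE. Qed.

Lemma differentiable_coordk k p : differentiable (fun p => coord p k) p.
Proof. exact: differentiable_coord. Qed.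

Lemma continuous_coord k : continuous (fun p => coord p k).
Proof. exact: coord_continuous. Qed.

(** The derivative of the identity along [v] is [v]; reading this in one entry gives the claim. *)
Lemma derive_coord k p v : 'D_v (fun p => coord p k) p = coord v k.
Proof.
have df : derivable (@idfun 'rV[R]_n.+1) p v by exact: derivable_id.
have := derive_mx df; rewrite derive_id => {2}->.
by rewrite /coord mxE.
Qed.

(** A neighbourhood of [p] contains a box given by a matrix of neighbourhoods, and a filter is
    stable under the finite intersection over the entries. *)
Lemma cvg_row (T : Type) (F : set_system T) {FF : Filter F}
    (f : T -> 'rV[R]_n.+1) p :
  (forall k, (k <= n)%N -> (fun t => coord (f t) k) @ F --> coord p k) ->
  f @ F --> p.
Proof.
move=> fp A [P Pp sPA].
have FP i : F (fun t => P ord0 i (f t ord0 i)).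
  have /(_ (P ord0 i)) := fp i (ltn_ord i).
  by rewrite /coord inord_val; apply; exact: Pp.
have /= FA := @filter_forall _ _ _ _ FF FP.
by apply: (filterS _ FA) => t Pt; apply: sPA => i j; rewrite (ord1 i).
Qed.

End RowVectors.

(** * Smoothness of maps built from sums, products and exponentials *)

Section ExponentialPolynomials.
Variables (R : realType) (n : nat).

(* Being closed under directional derivatives, this class of functions consists
   of smooth ones. *)
Inductive term : Type :=
  | Cst of R | Var of nat | Add of term & term | Mul of term & term
  | Exp of term.

Fixpoint eval (t : term) (p : 'rV[R]_n.+1) : R :=
  match t with
  | Cst c => c
  | Var k => coord p k
  | Add t u => eval t p + eval u p
  | Mul t u => eval t p * eval u p
  | Exp t => expR (eval t p)
  end.

Fixpoint Dterm (v : 'rV[R]_n.+1) (t : term) : term :=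
  match t with
  | Cst c => Cst 0
  | Var k => Cst (coord v k)
  | Add t u => Add (Dterm v t) (Dterm v u)
  | Mul t u => Add (Mul (Dterm v t) u) (Mul t (Dterm v u))
  | Exp t => Mul (Exp t) (Dterm v t)
  end.

Lemma differentiable_eval t p : differentiable (eval t) p.
Proof.
elim: t => [c|k|t dt u du|t dt u du|t dt] /=.
- exact: differentiable_cst.
- exact: differentiable_coordk.
- exact: differentiableD.
- exact: differentiableM.
- apply: (differentiable_comp dt).
  exact/derivable1_diffP/derivable_expR.
Qed.

Lemma derivable_eval t p v : derivable (eval t) p v.
Proof. exact/diff_derivable/differentiable_eval. Qed.

Lemma derive_eval t p v : 'D_v (eval t) p = eval (Dterm v t) p.
Proof.
elim: t => [c|k|t dt u du|t dt u du|t dt] /=.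
- exact: derive_cst.
- exact: derive_coord.
- by rewrite -dt -du; apply: deriveD; exact: derivable_eval.
- rewrite -dt -du addrC mulrC [X in _ = _ + X]mulrC mulrC.
  by apply: deriveM; exact: derivable_eval.
- rewrite -dt (deriveE _ (differentiable_eval (Exp t) p)).
  rewrite (deriveE _ (differentiable_eval t p)).
  have de : differentiable (@expR R) (eval t p).
    exact/derivable1_diffP/derivable_expR.
  rewrite (diff_comp (differentiable_eval t p) de) /=.
  by rewrite diff1E // derive1E derive_val [LHS]mulrC.
Qed.

Definition row_eval m (ts : nat -> term) (p : 'rV[R]_n.+1) : 'rV[R]_m.+1 :=
  \row_(i < m.+1) eval (ts i) p.

Lemma coord_row_eval m ts p k : (k <= m)%N ->
  coord (@row_eval m ts p) k = eval (ts k) p.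
Proof. exact: (coord_row (fun k => eval (ts k) p)). Qed.

Lemma derivable_row_eval m ts p v : derivable (@row_eval m ts) p v.
Proof.
apply/derivable_mxP => i j.
have -> : (fun q => @row_eval m ts q i j) = eval (ts j).
  by apply/funext => q; rewrite mxE.
exact: derivable_eval.
Qed.

Lemma derive_row_eval m ts p v :
  'D_v (@row_eval m ts) p = row_eval m (Dterm v \o ts) p.
Proof.
rewrite derive_mx; last exact: derivable_row_eval.
apply/rowP => j; rewrite !mxE /= -derive_eval; congr ('D_v _ p).
by apply/funext => q; rewrite mxE.
Qed.

(** Each directional derivative is absorbed into the terms by [Dterm], so continuity and
    derivability need to be checked only for a single [row_eval]. *)
Lemma iterD_row_eval m vs ts :
  exists ts', iterD vs (@row_eval m ts) = row_eval m ts'.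
Proof.
elim: vs ts => [|v vs IH] ts /=; first by exists ts.
have -> : (fun x => 'D_v (@row_eval m ts) x) = row_eval m (Dterm v \o ts).
  by apply/funext => p; exact: derive_row_eval.
exact: IH.
Qed.

Lemma continuous_row_eval m ts : continuous (@row_eval m ts).
Proof.
move=> p; apply: (@cvg_row _ _ _ (nbhs p)) => k km; rewrite coord_row_eval //.
have -> : (fun t => coord (@row_eval m ts t) k) = eval (ts k).
  by apply/funext => q; rewrite coord_row_eval.
exact/differentiable_continuous/differentiable_eval.
Qed.

Lemma smooth_row_eval m ts : smooth (@row_eval m ts).
Proof.
move=> vs; have [ts' ->] := iterD_row_eval m vs ts.
by split=> [|x v]; [exact: continuous_row_eval | exact: derivable_row_eval].
Qed.

End ExponentialPolynomials.

(** * Rank one and semi-definiteness as conditions on determinant and trace *)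

Section Ricci.
Variable R : realType.
Implicit Types (M : 'M[R]_2) (q : 'rV[R]_6).

Lemma sqr1_neq0 (x : R) : x ^+ 2 = 1 -> x != 0.
Proof.
by move=> x1; apply/eqP => x0; move/eqP: x1; rewrite x0 expr0n /= eq_sym oner_eq0.
Qed.

(** A vanishing determinant excludes rank 2, and a nonzero matrix excludes rank 0. *)
Lemma rank1_mx22 M : \rank M = 1%N <-> \det M = 0 /\ M != 0.
Proof.
split=> [rM|[dM M0]].
  split; last by rewrite -mxrank_eq0 rM.
  apply/eqP; rewrite -[_ == _]negbK -unitfE -unitmxE -row_free_unit.
  by rewrite /row_free rM.
apply/eqP; rewrite eqn_leq lt0n mxrank_eq0 M0 andbT -ltnS ltn_neqAle.
rewrite rank_leq_row andbT -[_ == _]/(row_free M) row_free_unit unitmxE.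
by rewrite unitfE dM eqxx.
Qed.

Lemma det_mx2 M : \det M = M 0 0 * M 1 1 - M 0 1 * M 1 0.
Proof.
have l1 : lift ord0 ord0 = 1 :> 'I_2 by exact/val_inj.
have l10 : lift 1 ord0 = 0 :> 'I_2 by exact/val_inj.
rewrite (expand_det_row _ 0) !big_ord_recl big_ord0 /cofactor !det_mx11 !mxE.
rewrite !l1 !l10 /= /bump /= expr0 expr1; ring.
Qed.

Lemma quad_form22 M (v : 'cV[R]_2) : (v^T *m M *m v) 0 0 =
  M 0 0 * v 0 0 ^+ 2 + (M 0 1 + M 1 0) * v 0 0 * v 1 0 + M 1 1 * v 1 0 ^+ 2.
Proof.
have l1 : lift ord0 ord0 = 1 :> 'I_2 by exact/val_inj.
rewrite mxE !big_ord_recl big_ord0 !mxE !big_ord_recl !big_ord0 !mxE l1.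
ring.
Qed.

Definition rho11 q := (coord q 0 - coord q 3) * coord q 3
  + coord q 1 * (coord q 5 - coord q 2).
Definition rho12 q := coord q 2 * coord q 3 - coord q 1 * coord q 4.
Definition rho22 q := coord q 2 * (coord q 5 - coord q 2)
  + (coord q 0 - coord q 3) * coord q 4.

Lemma ricciv00 q : ricciv q 0 0 = rho11 q. Proof. by rewrite mxE. Qed.
Lemma ricciv01 q : ricciv q 0 1 = rho12 q. Proof. by rewrite mxE. Qed.
Lemma ricciv10 q : ricciv q 1 0 = rho12 q. Proof. by rewrite mxE. Qed.
Lemma ricciv11 q : ricciv q 1 1 = rho22 q. Proof. by rewrite mxE. Qed.
Definition riccivE := (ricciv00, ricciv01, ricciv10, ricciv11).

(** The sign [eps] is 1 or -1 in the applications, so that both semi-definite cases are treated at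
    once. *)
Definition rank1_cone (eps : R) : set 'rV[R]_6 := [set q |
  rho11 q * rho22 q = rho12 q ^+ 2 /\ 0 < eps * (rho11 q + rho22 q)].

(** Forwards, the sign of the trace decides the sign of the quadratic form. Backwards, the basis
    vectors show that the diagonal entries have the sign [eps]; if the trace vanished, so would both
    of them, then [rho12] by the determinant, and the matrix would be zero. *)
Lemma rank1_coneP eps q : eps ^+ 2 = 1 ->
  rank1_cone eps q <-> \rank (ricciv q) = 1%N /\
    forall v : 'cV[R]_2, 0 <= eps * ((v^T *m ricciv q *m v) 0 0).
Proof.
move=> eps1; have det_ricci : \det (ricciv q) = rho11 q * rho22 q - rho12 q ^+ 2.
  by rewrite det_mx2 !riccivE expr2.
rewrite rank1_mx22 det_ricci; split=> [[det0 tr0]|[[/eqP]]].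
  rewrite det0 subrr; split; [split=> //|].
    apply: contraTneq tr0 => M0.
    by rewrite -ricciv00 -ricciv11 M0 !mxE addr0 mulr0 ltxx.
  move=> v; rewrite quad_form22 !riccivE; rewrite -(pmulr_rge0 _ tr0).
  set x := v 0 0; set y := v 1 0.
  (* A singular 2 by 2 matrix M satisfies M^2 = (tr M) M by Cayley-Hamilton; for symmetric M the
     trace times the form at v is therefore |M v|^2. *)
  suff -> : eps * (rho11 q + rho22 q) * (eps * (rho11 q * x ^+ 2 +
      (rho12 q + rho12 q) * x * y + rho22 q * y ^+ 2)) =
      (rho11 q * x + rho12 q * y) ^+ 2 + (rho12 q * x + rho22 q * y) ^+ 2.
    by rewrite addr_ge0 ?sqr_ge0.
  by ring: det0 eps1.
rewrite subr_eq0 => /eqP det0 M0 pos; split=> //.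
have p11 : 0 <= eps * rho11 q.
  have := pos (\col_i (i == 0)%:R).
  by rewrite quad_form22 !riccivE !mxE /= expr1n expr0n /= !(mulr0, mulr1, addr0).
have p22 : 0 <= eps * rho22 q.
  have := pos (\col_i (i == 1)%:R).
  rewrite quad_form22 !riccivE !mxE /= expr1n expr0n /=.
  by rewrite !(mulr0, mulr1, addr0, add0r).
rewrite lt_neqAle mulrDr addr_ge0 // andbT eq_sym.
rewrite paddr_eq0 //; apply: contraNN M0 => /andP[/eqP e11 /eqP e22].
have eps0 := sqr1_neq0 eps1.
have r11 : rho11 q = 0 by apply/eqP; move/eqP: e11; rewrite mulf_eq0 (negbTE eps0).
have r22 : rho22 q = 0 by apply/eqP; move/eqP: e22; rewrite mulf_eq0 (negbTE eps0).
have r12 : rho12 q = 0.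
  by apply/eqP; rewrite -sqrf_eq0 -det0 r11 mul0r.
apply/eqP/matrixP => i j; rewrite [RHS]mxE.
have ord2 (k : 'I_2) : k = 0 \/ k = 1.
  by case: k => [[|[|//]] k2]; [left|right]; exact/val_inj.
by case: (ord2 i) (ord2 j) => -> [] ->; rewrite riccivE.
Qed.

Lemma A1plusE : @A1plus R = rank1_cone 1.
Proof.
apply/seteqP; split=> q; rewrite rank1_coneP ?expr1n // => -[rk H]; split=> // v.
  by rewrite mul1r; exact: H.
by have := H v; rewrite mul1r.
Qed.

Lemma A1minusE : @A1minus R = rank1_cone (-1).
Proof.
apply/seteqP; split=> q; rewrite rank1_coneP ?sqrrN ?expr1n // => -[rk H];
  split=> // v.
  by rewrite mulN1r oppr_ge0; exact: H.
by have := H v; rewrite mulN1r oppr_ge0.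
Qed.

End Ricci.

(** * The parametrization, its inverse, and the embedding property *)

Section Parametrization.
Variable R : realType.
Variable eps : R.
Hypothesis eps1 : eps ^+ 2 = 1.
Implicit Types (p v : 'rV[R]_7) (q : 'rV[R]_6).

Definition Sub (t u : term R) := Add t (Mul (Cst (-1)) u).

(* Coordinates of R^7: C, S, W = (w1, w2), ln m, ln |k| and s, with k the
   signed factor such that rho11 = 2 m k (1 + C). *)
Definition param_term : nat -> term R :=
  let C := Var R 0 in let S := Var R 1 in
  let w1 := Var R 2 in let w2 := Var R 3 in
  let m := Exp (Var R 4) in let k := Mul (Cst eps) (Exp (Var R 5)) in
  let s := Var R 6 in
  let Cp := Add (Cst 1) C in let Cm := Sub (Cst 1) C in
  let x := Sub (Mul s Cp) (Mul m S) in let y := Add (Mul s Cm) (Mul m S) in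
  let d := Sub (Mul (Mul k Cp) w1) (Mul x w2) in
  let b := Add (Mul (Mul k Cp) w2) (Mul x w1) in
  let e := Sub (Mul (Mul k Cm) w1) (Mul y w2) in
  let c := Add (Mul (Mul k Cm) w2) (Mul y w1) in
  let a := Add (Mul (Mul (Cst 2) m) w1) d in
  let f := Add (Mul (Mul (Cst 2) m) w2) c in
  nth (Cst 0) [:: a; b; c; d; e; f].

Definition param : 'rV[R]_7 -> 'rV[R]_6 := row_eval 5 param_term.

(** Here [r] is |Z| = 2m and the trace is 4mk, which explains the arguments of both logarithms. The
    last entry is (x + y) / 2, which equals s because (1 + C) + (1 - C) = 2. *)
Definition chart_coord q : nat -> R :=
  let r := Num.sqrt ((coord q 0 - coord q 3) ^+ 2 +
                     (coord q 5 - coord q 2) ^+ 2) in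
  let w1 := (coord q 0 - coord q 3) / r in
  let w2 := (coord q 5 - coord q 2) / r in
  let tr := rho11 q + rho22 q in
  nth 0 [:: (rho11 q - rho22 q) / tr; 2 * rho12 q / tr; w1; w2;
    ln (r / 2); ln (eps * tr / (2 * r));
    ((coord q 1 + coord q 2) * w1 - (coord q 3 + coord q 4) * w2) / 2].

Definition chart q : 'rV[R]_7 := \row_i chart_coord q i.

Lemma T2R3_sqr p : T2R3 p -> coord p 1 ^+ 2 = 1 - coord p 0 ^+ 2 /\
  coord p 3 ^+ 2 = 1 - coord p 2 ^+ 2.
Proof. by case=> CS W; split; [rewrite -CS|rewrite -W]; ring. Qed.

(** In the orthonormal frame (W, JW), Z is 2mW while X and Y have W-components k(1 + C) and k(1 -
    C). In X ^ Y = k((1 + C) y - (1 - C) x) the terms in s cancel and 2mkS remains. *)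
Lemma rho_param p : T2R3 p ->
  [/\ rho11 (param p) =
        2 * eps * expR (coord p 4) * expR (coord p 5) * (1 + coord p 0),
      rho22 (param p) =
        2 * eps * expR (coord p 4) * expR (coord p 5) * (1 - coord p 0) &
      rho12 (param p) =
        2 * eps * expR (coord p 4) * expR (coord p 5) * coord p 1].
Proof.
move=> /T2R3_sqr[_ W1]; rewrite /rho11 /rho22 /rho12 !coord_row_eval //=.
by split; ring: W1.
Qed.

Lemma rank1_cone_param p : T2R3 p -> rank1_cone eps (param p).
Proof.
move=> Tp; have [r11 r22 r12] := rho_param Tp; case/T2R3_sqr: Tp => CS1 _.
rewrite /rank1_cone /= r11 r22 r12; split; first by ring: CS1.
have -> : forall m k C : R, eps * (2 * eps * m * k * (1 + C) +
    2 * eps * m * k * (1 - C)) = 4 * m * k by move=> *; ring: eps1.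
by rewrite !mulr_gt0 ?expR_gt0.
Qed.

Lemma rank1_cone_tr_neq0 q : rank1_cone eps q -> rho11 q + rho22 q != 0.
Proof. by case=> _; apply: contraTneq => ->; rewrite mulr0 ltxx. Qed.

Lemma rank1_cone_Z_gt0 q : rank1_cone eps q ->
  0 < (coord q 0 - coord q 3) ^+ 2 + (coord q 5 - coord q 2) ^+ 2.
Proof.
move=> [_ tr0]; rewrite lt_neqAle addr_ge0 ?sqr_ge0 // andbT eq_sym.
rewrite paddr_eq0 ?sqr_ge0 // !sqrf_eq0.
apply: contraTN tr0 => /andP[/eqP u0 /eqP v0].
by rewrite /rho11 /rho22 u0 v0 !(mul0r, mulr0, addr0) ltxx.
Qed.

Lemma norm_Z_param p : T2R3 p ->
  Num.sqrt ((coord (param p) 0 - coord (param p) 3) ^+ 2 +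
            (coord (param p) 5 - coord (param p) 2) ^+ 2)
  = 2 * expR (coord p 4).
Proof.
move=> /T2R3_sqr[_ W1]; rewrite !coord_row_eval //=.
set m := expR _.
rewrite (_ : _ + _ = (2 * m) ^+ 2); last by ring: W1.
by rewrite sqrtr_sqr ger0_norm // mulr_ge0 ?expR_ge0.
Qed.

Lemma chartK p : T2R3 p -> chart (param p) = p.
Proof.
move=> Tp; have [r11 r22 r12] := rho_param Tp; have rE := norm_Z_param Tp.
have m0 : expR (coord p 4) != 0 by rewrite gt_eqF ?expR_gt0.
have k0 : expR (coord p 5) != 0 by rewrite gt_eqF ?expR_gt0.
have e0 := sqr1_neq0 eps1.
case/T2R3_sqr: Tp => CS1 W1.
have w1E : (coord (param p) 0 - coord (param p) 3) / (2 * expR (coord p 4))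
    = coord p 2.
  by rewrite !coord_row_eval //=; field; rewrite m0.
have w2E : (coord (param p) 5 - coord (param p) 2) / (2 * expR (coord p 4))
    = coord p 3.
  by rewrite !coord_row_eval //=; field; rewrite m0.
have trE : rho11 (param p) + rho22 (param p) =
    4 * eps * expR (coord p 4) * expR (coord p 5).
  by rewrite r11 r22; ring.
apply: coord_inj => k k6; rewrite coord_row // /chart_coord.
rewrite rE w1E w2E trE r11 r22 r12.
case: k k6 => [|[|[|[|[|[|[|//]]]]]]] _ /=.
- by field; rewrite m0 k0 e0.
- by field; rewrite m0 k0 e0.
- by [].
- by [].
- by rewrite mulrC mulKf // expRK.
- rewrite (_ : _ / _ = expR (coord p 5)) ?expRK //.
  (* The sign in the trace meets the [eps] of the chart, and their product 1 leaves a positive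
     argument for the logarithm. *)
  rewrite (_ : eps * _ = eps ^+ 2 * (4 * expR (coord p 4) * expR (coord p 5)));
    last by ring.
  by rewrite eps1; field; rewrite m0.
- rewrite !coord_row_eval //=.
  by field: W1.
Qed.

(** The first circle equation is (tr)^2 - 4 det = (tr)^2, as the determinant vanishes; the second
    normalises Z. *)
Lemma T2R3_chart q : rank1_cone eps q -> T2R3 (chart q).
Proof.
move=> Aq; have Z0 := rank1_cone_Z_gt0 Aq.
have trN := rank1_cone_tr_neq0 Aq; case: Aq => det0 tr0.
split; rewrite !coord_row //=.
  rewrite !expr_div_n -mulrDl.
  have -> : (rho11 q - rho22 q) ^+ 2 + (2 * rho12 q) ^+ 2 =
    (rho11 q + rho22 q) ^+ 2 by ring: det0.
  by rewrite divff // expf_neq0.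
by rewrite !expr_div_n sqr_sqrtr ?ltW // -mulrDl divff // gt_eqF.
Qed.

(** The components of X and Y in the frame (W, JW) are recovered first: [kCp], [kCm] along W and
    [xE], [yE] along JW. Then [frame1] and [frame2] rebuild each vector from its components. *)
Lemma paramK q : rank1_cone eps q -> param (chart q) = q.
Proof.
move=> Aq; have Z0 := rank1_cone_Z_gt0 Aq.
have trN := rank1_cone_tr_neq0 Aq; case: Aq => _ tr0.
set u := coord q 0 - coord q 3 in Z0 *; set v := coord q 5 - coord q 2 in Z0 *.
set r := Num.sqrt (u ^+ 2 + v ^+ 2).
have r0 : 0 < r by rewrite sqrtr_gt0.
have rN : r != 0 by rewrite gt_eqF.
have r2 : r ^+ 2 = u ^+ 2 + v ^+ 2 by exact: sqr_sqrtr (ltW Z0).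
have mE : expR (chart_coord q 4) = r / 2 by rewrite /= lnK // posrE divr_gt0.
have kE : eps * expR (chart_coord q 5) = (rho11 q + rho22 q) / (2 * r).
  rewrite /= lnK ?posrE; last by rewrite divr_gt0 // mulr_gt0.
  by rewrite -/r !mulrA -expr2 eps1 mul1r.
have kCp : eps * expR (chart_coord q 5) * (1 + chart_coord q 0) = rho11 q / r.
  by rewrite kE /chart_coord /=; field; rewrite rN.
have kCm : eps * expR (chart_coord q 5) * (1 - chart_coord q 0) = rho22 q / r.
  by rewrite kE /chart_coord /=; field; rewrite rN.
have r11 : rho11 q = u * coord q 3 + v * coord q 1.
  by rewrite /rho11 -/u -/v mulrC [coord q 1 * _]mulrC [coord q 3 * _]mulrC.
have r22 : rho22 q = u * coord q 4 + v * coord q 2.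
  by rewrite /rho22 -/u -/v addrC [coord q 2 * _]mulrC.
(* With s = (x + y) / 2 the left side is ((x + y) rho11 - r rho12) / tr. Since r rho12 = rho11 y -
   rho22 x, the numerator is x tr. *)
have xE : chart_coord q 6 * (1 + chart_coord q 0)
    - expR (chart_coord q 4) * chart_coord q 1 =
    (u * coord q 1 - v * coord q 3) / r.
  rewrite mE /chart_coord /= -/u -/v -/r.
  move: trN; rewrite r11 r22 /rho12 => trN.
  by field: r2; rewrite rN trN.
have yE : chart_coord q 6 * (1 - chart_coord q 0)
    + expR (chart_coord q 4) * chart_coord q 1 =
    (u * coord q 2 - v * coord q 4) / r.
  rewrite mE /chart_coord /= -/u -/v -/r.
  move: trN; rewrite r11 r22 /rho12 => trN.
  by field: r2; rewrite rN trN.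
have w1E : chart_coord q 2 = u / r by [].
have w2E : chart_coord q 3 = v / r by [].
apply: coord_inj => k k6; rewrite coord_row_eval //.
have chartE i : (i <= 6)%N -> coord (chart q) i = chart_coord q i.
  exact: coord_row.
have subE (t t' : R) : t + -1 * t' = t - t' by rewrite mulN1r.
have frame1 (a b : R) : (u * a + v * b) / r * (u / r) -
    (u * b - v * a) / r * (v / r) = a by field: r2.
have frame2 (a b : R) : (u * a + v * b) / r * (v / r) +
    (u * b - v * a) / r * (u / r) = b by field: r2.
case: k k6 => [|[|[|[|[|[|//]]]]]] _ /=;
  rewrite !chartE // !subE ?kCp ?kCm ?xE ?yE ?mE ?w1E ?w2E
    ?r11 ?r22 ?frame1 ?frame2 //.
- by rewrite [2 * _]mulrC divfK ?pnatr_eq0 // [r * _]mulrC divfK // subrK.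
- by rewrite [2 * _]mulrC divfK ?pnatr_eq0 // [r * _]mulrC divfK // subrK.
Qed.

(** A tangent vector in the kernel is eliminated in stages: the derivative of Z removes [v] in the
    directions of W and m, then the W-components of the derivatives of X and Y remove those of C and
    k, and the JW-components those of S and s. *)
Lemma immersion_param p v : T2R3 p -> T2R3_tangent p v ->
  v != 0 -> 'D_v param p != 0.
Proof.
move=> /T2R3_sqr[_ W1] [_ Wv]; apply: contraNN => /eqP.
rewrite derive_row_eval => D0.
pose D k := eval (Dterm v (param_term k)) p.
have DE k : (k <= 5)%N -> D k = 0.
  move=> k5; rewrite /D -[Dterm _ _]/((Dterm v \o param_term) k).
  by rewrite -(coord_row_eval _ _ k5) D0 coord0.
pose m := expR (coord p 4); pose k := expR (coord p 5).
have m0 : m != 0 by rewrite gt_eqF ?expR_gt0.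
have k0 : eps * k != 0 by rewrite mulf_neq0 ?(sqr1_neq0 eps1) // gt_eqF ?expR_gt0.
have Z1 : coord v 4 * coord p 2 + coord v 2 = 0.
  apply: (mulfI m0); rewrite mulr0; apply: (mulfI (_ : (2 : R) != 0)).
    by rewrite pnatr_eq0.
  by rewrite mulr0 -[RHS](subrr 0) -{1}(DE 0) // -(DE 3) // /D /m /=; ring.
have Z2 : coord v 4 * coord p 3 + coord v 3 = 0.
  apply: (mulfI m0); rewrite mulr0; apply: (mulfI (_ : (2 : R) != 0)).
    by rewrite pnatr_eq0.
  by rewrite mulr0 -[RHS](subrr 0) -{1}(DE 5) // -(DE 2) // /D /m /=; ring.
(* The scalar product with W isolates this entry: W has norm 1 and is orthogonal to its own
   variation by tangency. *)
have v4 : coord v 4 = 0.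
  rewrite -[LHS](_ : coord p 2 * (coord v 4 * coord p 2 + coord v 2) +
    coord p 3 * (coord v 4 * coord p 3 + coord v 3) = _).
    by rewrite Z1 Z2 !mulr0 addr0.
  rewrite -[RHS]addr0 -Wv; ring: W1.
have v2 : coord v 2 = 0 by move: Z1; rewrite v4 mul0r add0r.
have v3 : coord v 3 = 0 by move: Z2; rewrite v4 mul0r add0r.
have X1 : (1 + coord p 0) * coord v 5 + coord v 0 = 0.
  apply: (mulfI k0); rewrite mulr0.
  transitivity (coord p 2 * D 3 + coord p 3 * D 1).
    by rewrite /D /k /= v2 v3 v4; ring: W1.
  by rewrite !DE // !mulr0 addr0.
have Y1 : (1 - coord p 0) * coord v 5 - coord v 0 = 0.
  apply: (mulfI k0); rewrite mulr0.
  transitivity (coord p 2 * D 4 + coord p 3 * D 2).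
    by rewrite /D /k /= v2 v3 v4; ring: W1.
  by rewrite !DE // !mulr0 addr0.
(* In the sum of [X1] and [Y1] all terms with C and its variation cancel, leaving twice this entry;
   [X2] and [Y2] are used in the same way below. *)
have v5 : coord v 5 = 0 by lra.
have v0 : coord v 0 = 0 by move: X1; rewrite v5 mulr0 add0r.
have X2 : coord v 6 * (1 + coord p 0) - m * coord v 1 = 0.
  transitivity (coord p 2 * D 1 - coord p 3 * D 3).
    by rewrite /D /m /= v2 v3 v4 v0; ring: W1.
  by rewrite !DE // !mulr0 subr0.
have Y2 : coord v 6 * (1 - coord p 0) + m * coord v 1 = 0.
  transitivity (coord p 2 * D 2 - coord p 3 * D 4).
    by rewrite /D /m /= v2 v3 v4 v0; ring: W1.
  by rewrite !DE // !mulr0 subr0.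
have v6 : coord v 6 = 0 by lra.
have v1 : coord v 1 = 0.
  by apply: (mulfI m0); move: Y2; rewrite v6 mul0r add0r mulr0.
apply/eqP/coord_inj => i i6; rewrite coord0.
by case: i i6 => [|[|[|[|[|[|[|//]]]]]]].
Qed.

(** Continuity holds even in the ambient space at each point of the cone: there the denominators are
    nonzero and the arguments of [ln] positive. *)
Lemma continuous_chart : {within rank1_cone eps, continuous chart}.
Proof.
apply: continuous_in_subspaceT => q; rewrite inE => Aq.
have Z0 := rank1_cone_Z_gt0 Aq.
have trN := rank1_cone_tr_neq0 Aq; case: Aq => _ tr0.
have cD (f g : 'rV[R]_6 -> R) : {for q, continuous f} ->
  {for q, continuous g} -> {for q, continuous (fun x => f x + g x)}.
  exact: continuousD.
have cB (f g : 'rV[R]_6 -> R) : {for q, continuous f} ->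
  {for q, continuous g} -> {for q, continuous (fun x => f x - g x)}.
  exact: continuousB.
have cM (f g : 'rV[R]_6 -> R) : {for q, continuous f} ->
  {for q, continuous g} -> {for q, continuous (fun x => f x * g x)}.
  exact: continuousM.
have cV (f : 'rV[R]_6 -> R) : f q != 0 -> {for q, continuous f} ->
  {for q, continuous (fun x => (f x)^-1)} by move=> *; exact: continuousV.
have cL (f : 'rV[R]_6 -> R) : 0 < f q -> {for q, continuous f} ->
  {for q, continuous (fun x => ln (f x))}.
  by move=> f0 cf; apply: continuous_comp => //; exact: continuous_ln.
have cS (f : 'rV[R]_6 -> R) : {for q, continuous f} ->
  {for q, continuous (fun x => Num.sqrt (f x))}.
  by move=> cf; apply: continuous_comp => //; exact: sqrt_continuous.
have cc i : {for q, continuous (fun x : 'rV[R]_6 => coord x i)}.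
  exact: continuous_coord.
have ck (a : R) : {for q, continuous (fun _ : 'rV[R]_6 => a)}.
  exact: cst_continuous.
have c11 : {for q, continuous (@rho11 R)}.
  by apply: (cD (fun x => _ * _) (fun x => _ * _)); apply: (cM) => //; exact: (cB).
have c22 : {for q, continuous (@rho22 R)}.
  by apply: (cD (fun x => _ * _) (fun x => _ * _)); apply: (cM) => //; exact: (cB).
have c12 : {for q, continuous (@rho12 R)}.
  by apply: (cB (fun x => _ * _) (fun x => _ * _)); apply: (cM).
have r0 : 0 < Num.sqrt ((coord q 0 - coord q 3) ^+ 2 +
    (coord q 5 - coord q 2) ^+ 2) by rewrite sqrtr_gt0.
have rN := lt0r_neq0 r0.
have cr : {for q, continuous (fun x : 'rV[R]_6 =>
    Num.sqrt ((coord x 0 - coord x 3) ^+ 2 + (coord x 5 - coord x 2) ^+ 2))}.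
  (* A square unfolds to a product, so the rule for products applies to it. *)
  by apply: (cS); apply: (cD); apply: (cM); exact: (cB).
have c1 : {for q, continuous (fun x : 'rV[R]_6 => chart_coord x 2)}.
  by apply: (cM); [exact: (cB) | exact: (cV)].
have c2 : {for q, continuous (fun x : 'rV[R]_6 => chart_coord x 3)}.
  by apply: (cM); [exact: (cB) | exact: (cV)].
have ctr : {for q, continuous (fun x => (rho11 x + rho22 x)^-1)}.
  by apply: (cV) => //; exact: (cD).
apply: (@cvg_row _ _ _ (nbhs q)) => i i6; rewrite coord_row //.
rewrite (_ : (fun x => _) = chart_coord^~ i); last first.
  by apply/funext => x; rewrite coord_row.
case: i i6 => [|[|[|[|[|[|[|//]]]]]]] _.
- by apply: (cM) => //; exact: (cB).
- by apply: (cM) => //; exact: (cM).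
- exact: c1.
- exact: c2.
- by apply: (cL); [rewrite divr_gt0 | exact: (cM)].
- apply: (cL); first by rewrite divr_gt0 // mulr_gt0.
  apply: (cM); first by apply: (cM) => //; exact: (cD).
  by apply: (cV); [rewrite mulf_neq0 ?pnatr_eq0 | exact: (cM)].
- apply: (cM) => //; apply: (cB).
  + by apply: (cM) => //; exact: (cD).
  + by apply: (cM) => //; exact: (cD).
Qed.

Lemma rank1_cone_diffeo : submanifold_diffeo_T2R3 (rank1_cone eps).
Proof.
exists param; split.
- exact: smooth_row_eval.
- apply/seteqP; split=> [_ [p Tp <-]|q Aq]; first exact: rank1_cone_param.
  by exists (chart q); [exact: T2R3_chart | exact: paramK].
- exact: immersion_param.
- by exists chart; split; [exact: continuous_chart | exact: chartK].
Qed.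

End Parametrization.

Theorem theorem1p2 (R : realType) :
  submanifold_diffeo_T2R3 (@A1plus R) /\ submanifold_diffeo_T2R3 (@A1minus R).
Proof.
rewrite A1plusE A1minusE.
by split; apply: rank1_cone_diffeo; rewrite ?sqrrN expr1n.
Qed.
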